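(* Let $X=X_1\times\cdots\times X_N\subset\mathbb{R}^n$ with each $X_i\subset\mathbb{R}^{n_i}$ non-empty, compact and convex, let $f(x)=\frac12x^TQx+r^Tx$ with $Q\in\mathbb{R}^{n\times n}$ symmetric and strictly block diagonally dominant relative to $p=[n_1,\dots,n_N]^T$, and $r\in\mathbb{R}^n$, and let $\hat{x}=\arg\min_{x\in X}f(x)$. Let the update times $K^i$ and delays $\tau^j_i$ satisfy the total asynchrony assumption given in the context. Suppose each agent $i\in[N]$ chooses, independently of the other agents and using only knowledge of $Q^{[i]}$, a stepsize $$0<\gamma_i<\frac{2}{\sum_{j=1}^N\|Q^{[i]}_j\|_2}.$$ Then Algorithm 1 (described in the context) is a totally asynchronous distributed optimization algorithm, in which only agent $i$ updates $x^{[i]}$ and agents choose stepsizes independently, that solves the problem of minimizing $\frac12x^TQx+r^Tx$ over $x\in X$, and it asymptotically converges to $\hat{x}$: for every $i\in[N]$, agent $i$'s full local copy of the state satisfies $\lim_{k\to\infty}x_i(k)=\hat{x}$.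
   Context: Notation: $[N]=\{1,\dots,N\}$, $n_i\ge 1$, $n=\sum_{i=1}^N n_i$. A vector $x\in\mathbb{R}^n$ is partitioned as $x=(x^{[1]},\dots,x^{[N]})$ with $x^{[i]}\in\mathbb{R}^{n_i}$. A matrix $B\in\mathbb{R}^{n\times n}$ is partitioned into blocks $B^{[i]}_j\in\mathbb{R}^{n_i\times n_j}$, and $B^{[i]}=[B^{[i]}_1\ \cdots\ B^{[i]}_N]\in\mathbb{R}^{n_i\times n}$ is its $i$-th block row. $\|\cdot\|_2$ is the Euclidean norm or the induced matrix norm. $B$ is strictly block diagonally dominant relative to $p=[n_1,\dots,n_N]^T$ if every $B^{[i]}_i$ is nonsingular and $\big(\|(B^{[i]}_i)^{-1}\|_2\big)^{-1}>\sum_{j\ne i}\|B^{[i]}_j\|_2$ for all $i\in[N]$. $\Pi_{X_i}$ is Euclidean projection onto $X_i$. Algorithm 1: each agent $i\in[N]$ stores a local copy $x_i(k)=(x_i^{[1]}(k),\dots,x_i^{[N]}(k))$ of the full state at times $k=0,1,2,\dots$, with $x_i(0)\in X$. $K^i\subset\mathbb{N}$ is the set of times at which agent $i$ updates its own state. For all $i\in[N]$, $$x_i^{[i]}(k+1)=\Pi_{X_i}\big[x_i^{[i]}(k)-\gamma_i(Q^{[i]}x_i(k)+r^{[i]})\big]\ \text{if }k\in K^i,\qquad x_i^{[i]}(k+1)=x_i^{[i]}(k)\ \text{if }k\notin K^i,$$ and for $j\ne i$, $x_i^{[j]}(k+1)=x_j^{[j]}(\tau^j_i(k+1))$ if agent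 $i$ receives agent $j$'s state at time $k+1$, and $x_i^{[j]}(k+1)=x_i^{[j]}(k)$ otherwise. Here $\tau^j_i(k)$ is the time at which the value $x_i^{[j]}(k)$ was originally computed by agent $j$. No bounds on delays are imposed. Total asynchrony assumption: each $K^i$ is infinite, and for all $i\in[N]$, $j\in[N]\setminus\{i\}$, if $\{k_d\}_{d\in\mathbb{N}}$ is a sequence in $K^i$ tending to infinity then $\lim_{d\to\infty}\tau^j_i(k_d)=\infty$.
   Formalization: Q is also assumed positive semidefinite; x_i(k)→x̂ over all k is proved when τ^j_i(k)→∞ over all k for every j≠i; otherwise only x_i^{[i]}(k)→x̂^{[i]} over all k and x_i(k)→x̂ along k∈K^i. Without these additions the claim is false. *)

(* Defs.v *)
From HB Require Import structures.
From mathcomp Require Import all_boot all_order all_algebra.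
From mathcomp Require Import all_classical all_reals all_analysis.

Set Implicit Arguments.
Unset Strict Implicit.
Unset Printing Implicit Defensive.

Import Order.TTheory GRing.Theory Num.Theory.
Import numFieldNormedType.Exports.

Local Open Scope classical_set_scope.
Local Open Scope ring_scope.

(* R^n with n = \sum_i p i is 'cV[R]_(\sum_i p i), and blocks are those of
   matrix.v:
     x^[i] = submxcol x i,  B^[i] = submxcol B i,  B^[i]_j = submxblock B i j. *)

(* The library norm on matrices is the sup norm, hence the explicit Euclidean
   norm; both induce the canonical topology of 'cV[R]_n, in which compactness
   and convergence are stated. *)
Definition norm2 (R : realType) (n : nat) (v : 'cV[R]_n) : R :=
  Num.sqrt (\sum_i v i 0 ^+ 2).

Definition opnorm2 (R : realType) (m n : nat) (A : 'M[R]_(m, n)) : R :=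
  sup [set norm2 (A *m v) | v in [set v : 'cV[R]_n | norm2 v <= 1]].

Definition argmin (R : realType) (T : Type) (f : T -> R) (A : set T) : set T :=
  [set x | A x /\ forall y, A y -> f x <= f y].

(* The default value 0 is irrelevant when A is nonempty, compact and convex:
   the nearest point then exists and is unique. *)
Definition proj_onto (R : realType) (n : nat) (A : set 'cV[R]_n) (y : 'cV[R]_n)
    : 'cV[R]_n :=
  xget 0 (argmin (fun z => norm2 (z - y)) A).

Definition block_prod (R : realType) (N : nat) (p : 'I_N -> nat)
    (X : forall i : 'I_N, set 'cV[R]_(p i)) : set 'cV[R]_(\sum_i p i) :=
  [set x | forall i, X i (submxcol x i)].

Definition quadratic (R : realType) (n : nat) (Q : 'M[R]_n) (r x : 'cV[R]_n)
    : R :=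
  2^-1 * (x^T *m Q *m x) 0 0 + (r^T *m x) 0 0.

Definition strict_block_diag_dominant (R : realType) (N : nat)
    (p : 'I_N -> nat) (B : 'M[R]_(\sum_i p i)) : Prop :=
  forall i : 'I_N,
    submxblock B i i \in unitmx /\
    \sum_(j | j != i) opnorm2 (submxblock B i j)
      < (opnorm2 (invmx (submxblock B i i)))^-1.

(* K i         : times at which agent i updates its own block;
   rcv i j     : times at which agent i receives agent j's block;
   tau i j k   : time stamp tau^j_i(k) of the value of block j held by agent i
                 at time k;
   x i k       : agent i's local copy of the full state at time k.
   The time stamp changes only when a message is received and never lies in the
   future. Delays are unbounded and messages may arrive out of order. *)
Record async_run (R : realType) (N : nat) (p : 'I_N -> nat)
    (X : forall i : 'I_N, set 'cV[R]_(p i))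
    (Q : 'M[R]_(\sum_i p i)) (r : 'cV[R]_(\sum_i p i)) (gamma : 'I_N -> R)
    (K : 'I_N -> set nat) (rcv : 'I_N -> 'I_N -> set nat)
    (tau : 'I_N -> 'I_N -> nat -> nat)
    (x : 'I_N -> nat -> 'cV[R]_(\sum_i p i)) : Prop := AsyncRun {
  run_init : forall i, block_prod X (x i 0%N);
  run_update : forall i k, K i k ->
    submxcol (x i k.+1) i =
      proj_onto (X i)
        (submxcol (x i k) i
         - gamma i *: (submxcol Q i *m x i k + submxcol r i));
  run_idle : forall i k, ~ K i k ->
    submxcol (x i k.+1) i = submxcol (x i k) i;
  run_receive : forall i j k, j != i -> rcv i j k.+1 ->
    submxcol (x i k.+1) j = submxcol (x j (tau i j k.+1)) j;
  run_keep : forall i j k, j != i -> ~ rcv i j k.+1 ->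
    submxcol (x i k.+1) j = submxcol (x i k) j;
  run_stamp_keep : forall i j k, j != i -> ~ rcv i j k.+1 ->
    tau i j k.+1 = tau i j k;
  run_stamp_causal : forall i j k, j != i -> (tau i j k <= k)%N
}.

Definition totally_asynchronous (N : nat) (K : 'I_N -> set nat)
    (tau : 'I_N -> 'I_N -> nat -> nat) : Prop :=
  (forall i, infinite_set (K i)) /\
  (forall i j, j != i -> forall kd : nat -> nat,
     (forall d, K i (kd d)) -> kd @ \oo --> \oo ->
     (fun d => tau i j (kd d)) @ \oo --> \oo).

(* Main.v *)
(* In the block-maximum norm the projected gradient map is a contraction towards
   xhat: projections are nonexpansive, and the spectrum of Q^[i]_i lies in
   [1 / |(Q^[i]_i)^-1|, |Q^[i]_i|], so that diagonal dominance and the stepsize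
   bound give |I - gamma_i Q^[i]_i| + gamma_i \sum_(j != i) |Q^[i]_j| < 1. Total
   asynchrony then makes the local copies enter the boxes of radius q^s D around
   xhat one after the other. *)

Require Import Defs.
From HB Require Import structures.
From mathcomp Require Import all_boot all_order all_algebra.
From mathcomp Require Import all_classical all_reals all_analysis.
From mathcomp Require Import ring lra.

Import Order.TTheory GRing.Theory Num.Theory.
Import numFieldNormedType.Exports.

Local Open Scope classical_set_scope.
Local Open Scope ring_scope.

(** * Euclidean geometry, operator norms and spectral bounds for symmetric matrices *)

Section Euclidean.
Local Set Implicit Arguments.
Local Unset Strict Implicit.
Context {R : realType}.

Definition dot {n} (u v : 'cV[R]_n) : R := (u^T *m v) 0 0.

Lemma dotE n (u v : 'cV[R]_n) : dot u v = \sum_i u i 0 * v i 0.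
Proof. by rewrite /dot mxE; apply: eq_bigr => i _; rewrite mxE. Qed.

Lemma dotC n (u v : 'cV[R]_n) : dot u v = dot v u.
Proof. by rewrite !dotE; apply: eq_bigr => i _; rewrite mulrC. Qed.

Lemma dotDr n (u v w : 'cV[R]_n) : dot u (v + w) = dot u v + dot u w.
Proof. by rewrite /dot mulmxDr mxE. Qed.

Lemma dotNr n (u v : 'cV[R]_n) : dot u (- v) = - dot u v.
Proof. by rewrite /dot mulmxN mxE. Qed.

Lemma dotZr n a (u v : 'cV[R]_n) : dot u (a *: v) = a * dot u v.
Proof. by rewrite /dot -scalemxAr mxE. Qed.

Lemma dotDl n (u v w : 'cV[R]_n) : dot (u + v) w = dot u w + dot v w.
Proof. by rewrite dotC dotDr !(dotC w). Qed.

Lemma dotNl n (u v : 'cV[R]_n) : dot (- u) v = - dot u v.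
Proof. by rewrite dotC dotNr dotC. Qed.

Lemma dotZl n a (u v : 'cV[R]_n) : dot (a *: u) v = a * dot u v.
Proof. by rewrite dotC dotZr dotC. Qed.

Definition dot_lin := (dotDl, dotDr, dotNl, dotNr, dotZl, dotZr).

Lemma dot_mull m n (A : 'M[R]_(m, n)) u v : dot (A *m u) v = dot u (A^T *m v).
Proof. by rewrite /dot trmx_mul mulmxA. Qed.

Lemma dot_ge0 n (v : 'cV[R]_n) : 0 <= dot v v.
Proof. by rewrite dotE sumr_ge0 // => i _; rewrite -expr2 sqr_ge0. Qed.

Lemma norm2_ge0 n (v : 'cV[R]_n) : 0 <= norm2 v.
Proof. exact: sqrtr_ge0. Qed.

Lemma sqr_norm2 n (v : 'cV[R]_n) : norm2 v ^+ 2 = dot v v.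
Proof.
rewrite sqr_sqrtr ?sumr_ge0 // => [|i _]; last exact: sqr_ge0.
by rewrite dotE; apply: eq_bigr => i _; rewrite expr2.
Qed.

Lemma norm2_coord n (v : 'cV[R]_n) i : `|v i 0| <= norm2 v.
Proof.
rewrite -sqrtr_sqr ler_wsqrtr // (bigD1 i) //= lerDl sumr_ge0 // => j _.
exact: sqr_ge0.
Qed.

Lemma norm2_eq0 n (v : 'cV[R]_n) : norm2 v = 0 -> v = 0.
Proof.
move=> v0; apply/colP => i; apply/eqP.
by rewrite mxE -normr_le0 -v0 norm2_coord.
Qed.

Lemma norm2_le n m (u : 'cV[R]_n) (v : 'cV[R]_m) :
  (norm2 u <= norm2 v) = (dot u u <= dot v v).
Proof. by rewrite -!sqr_norm2 ler_pXn2r // nnegrE norm2_ge0. Qed.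

Lemma norm2Z n a (v : 'cV[R]_n) : norm2 (a *: v) = `|a| * norm2 v.
Proof.
apply/eqP; rewrite -(@eqrXn2 _ 2) ?mulr_ge0 ?norm2_ge0 //.
by rewrite exprMn real_normK ?num_real // !sqr_norm2 !dot_lin expr2 mulrA.
Qed.

Lemma norm20 n : norm2 (0 : 'cV[R]_n) = 0.
Proof. by rewrite -(scale0r 0) norm2Z normr0 mul0r. Qed.

Lemma norm2N n (v : 'cV[R]_n) : norm2 (- v) = norm2 v.
Proof. by rewrite -scaleN1r norm2Z normrN1 mul1r. Qed.

Lemma cauchy_schwarz n (u v : 'cV[R]_n) : dot u v <= norm2 u * norm2 v.
Proof.
have [/norm2_eq0 ->|u0] := eqVneq (norm2 u) 0.
  by rewrite norm20 mul0r -(scale0r 0) dotZl mul0r.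
have [/norm2_eq0 ->|v0] := eqVneq (norm2 v) 0.
  by rewrite norm20 mulr0 -(scale0r 0) dotZr mul0r.
(* This square expands to [2 * (a * b) * (a * b - dot u v)], whence the division by [a * b]. *)
have := dot_ge0 (norm2 v *: u - norm2 u *: v).
rewrite !dot_lin -!sqr_norm2 (dotC v u).
set a := norm2 u in u0 *; set b := norm2 v in v0 *.
have ab0 : 0 < a * b by rewrite mulr_gt0 // lt_def ?u0 ?v0 norm2_ge0.
move=> h; rewrite -(ler_pM2l ab0); nra.
Qed.

Lemma ler_norm2D n (u v : 'cV[R]_n) : norm2 (u + v) <= norm2 u + norm2 v.
Proof.
rewrite -(@ler_pXn2r _ 2) ?nnegrE ?addr_ge0 ?norm2_ge0 //.
rewrite sqrrD !sqr_norm2 !dot_lin (dotC v u).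
have := cauchy_schwarz u v; lra.
Qed.

Lemma ler_norm2_sum n (I : Type) (s : seq I) (P : pred I) (F : I -> 'cV[R]_n) :
  norm2 (\sum_(i <- s | P i) F i) <= \sum_(i <- s | P i) norm2 (F i).
Proof.
elim/big_ind2 : _ => [|u a v b ua vb|//]; first by rewrite norm20.
by rewrite (le_trans (ler_norm2D _ _)) // lerD.
Qed.

(** Makes the [sup] in [opnorm2] a genuine supremum: on the unit ball each coordinate is at most 1
    in absolute value, so the column norms add up to a bound. *)
Lemma opnorm2_has_ub m n (A : 'M[R]_(m, n)) :
  has_ubound [set norm2 (A *m v) | v in [set v : 'cV[R]_n | norm2 v <= 1]].
Proof.
exists (\sum_j norm2 (col j A)) => _ [v /= v1 <-].
have -> : A *m v = \sum_j v j 0 *: col j A.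
  apply/colP => i; rewrite mxE summxE; apply: eq_bigr => j _.
  by rewrite !mxE mulrC.
apply: le_trans (ler_norm2_sum _ _ _) _; apply: ler_sum => j _.
rewrite norm2Z ler_piMl ?norm2_ge0 //.
exact: le_trans (norm2_coord _ _) v1.
Qed.

Lemma opnorm2_ge0 m n (A : 'M[R]_(m, n)) : 0 <= opnorm2 A.
Proof.
apply: ub_le_sup; first exact: opnorm2_has_ub.
by exists 0; rewrite /= ?mulmx0 norm20.
Qed.

Lemma norm2_mulmx m n (A : 'M[R]_(m, n)) v :
  norm2 (A *m v) <= opnorm2 A * norm2 v.
Proof.
have [/norm2_eq0 ->|v0] := eqVneq (norm2 v) 0.
  by rewrite mulmx0 !norm20 mulr0.
have v_gt0 : 0 < norm2 v by rewrite lt_def v0 norm2_ge0.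
rewrite -ler_pdivrMr // mulrC.
rewrite -[X in X * _]ger0_norm ?invr_ge0 ?norm2_ge0 // -norm2Z scalemxAr.
apply: ub_le_sup; first exact: opnorm2_has_ub.
eexists; last reflexivity.
by rewrite /= norm2Z ger0_norm ?invr_ge0 ?norm2_ge0 // mulVf.
Qed.

(* Polarization:
     4 <tCv, Cv> = q(v + tCv) - q(v - tCv) <= 2 rho (|v|^2 + t^2 |Cv|^2)
   for q(v) = <v, Cv>, taken at t = 1 / rho. *)
Lemma norm2_sym_mulmx n (C : 'M[R]_n) (rho : R) : C^T = C -> 0 < rho ->
  (forall v, `|dot v (C *m v)| <= rho * dot v v) ->
  forall v, norm2 (C *m v) <= rho * norm2 v.
Proof.
move=> Csym rho0 hC v; set w := C *m v.
have vCw u : dot v (C *m u) = dot w u by rewrite /w dot_mull Csym.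
have /ler_normlP[_ hp] := hC (v + rho^-1 *: w).
have /ler_normlP[hm _] := hC (v - rho^-1 *: w).
rewrite -(ger0_norm (ltW rho0)) -norm2Z norm2_le.
move: hp hm; rewrite !mulmxDr !mulmxN -!scalemxAr !dot_lin -/w !vCw.
rewrite (dotC w v).
set c := dot w w; set b := dot v w; set a := dot v v; set d := dot w _.
set t := rho^-1; have rt : rho * t = 1 by rewrite /t mulfV // gt_eqF.
move=> hp hm.
(* As [rho * t = 1], the last term is half the left side; multiplying what remains by [rho] yields
   the squared claim. *)
have : 4 * t * c <= 2 * rho * a + 2 * (rho * t) * t * c by nra.
rewrite rt => h.
have : 2 * (rho * t) * c <= 2 * rho * rho * a by nra.
rewrite rt; lra.
Qed.

(** Lower end of the spectrum without diagonalization: with [w] the preimage of [v] and [t = mu^-1],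
    expand the form at [v - t *: w] and use [t * dot w v <= dot v v]. *)
Lemma dot_psd_ge n (A : 'M[R]_n) : A \in unitmx -> A^T = A ->
  (forall v, 0 <= dot v (A *m v)) ->
  0 < opnorm2 (invmx A) ->
  forall v, (opnorm2 (invmx A))^-1 * dot v v <= dot v (A *m v).
Proof.
move=> Au Asym Apsd; set mu := opnorm2 _ => mu0 v.
set w := invmx A *m v; set t := mu^-1.
have Aw : A *m w = v by rewrite mulmxA mulmxV // mul1mx.
have wv : dot w v <= mu * dot v v.
  apply: le_trans (cauchy_schwarz _ _) _.
  by rewrite -sqr_norm2 expr2 mulrA ler_wpM2r ?norm2_ge0 ?norm2_mulmx.
have := Apsd (v - t *: w).
rewrite mulmxDr mulmxN -scalemxAr Aw !dot_lin.
have -> : dot w (A *m v) = dot v v by rewrite dotC dot_mull Asym Aw.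
have t0 : 0 < t by rewrite invr_gt0.
have : t * (t * dot w v) <= t * dot v v.
  rewrite ler_pM2l // -(ler_pM2l mu0) mulrA mulfV ?gt_eqF // mul1r.
  exact: wv.
lra.
Qed.

(** The form of [A] lies between [m] and [M], so [1 - g * m] and [g * M - 1] control the symmetric
    matrix [1 - g *: A]. Both stay below [1 - g * s], the first by [s < m], the second by
    [g * (M + s) < 2]. *)
Lemma gradient_step_contraction n (A : 'M[R]_n) (s g : R) : (0 < n)%N ->
  A^T = A -> (forall v, 0 <= dot v (A *m v)) -> A \in unitmx ->
  0 <= s < (opnorm2 (invmx A))^-1 -> 0 < g < 2 / (opnorm2 A + s) ->
  exists2 rho, 0 <= rho &
    rho + g * s < 1 /\ forall v, norm2 (v - g *: (A *m v)) <= rho * norm2 v.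
Proof.
move=> n0 Asym Apsd Au; set m := _^-1; set M := opnorm2 A => /andP[s0 sm].
move=> /andP[g0 gM].
have lo v : m * dot v v <= dot v (A *m v).
  apply: dot_psd_ge => //; rewrite -invr_gt0; exact: le_lt_trans sm.
have hi v : dot v (A *m v) <= M * dot v v.
  apply: le_trans (cauchy_schwarz _ _) _.
  by rewrite mulrC -sqr_norm2 expr2 mulrA ler_wpM2r ?norm2_ge0 ?norm2_mulmx.
(* Comparing both bounds at a nonzero vector requires [0 < n]. The outcome gives [g * s < 1]. *)
have mM : m <= M.
  pose e : 'cV[R]_n := const_mx 1.
  have e0 : 0 < dot e e.
    rewrite dotE (bigD1 (Ordinal n0)) //= ltr_pwDl //.
      by rewrite !mxE mulr1.
    by rewrite sumr_ge0 // => i _; rewrite -expr2 sqr_ge0.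
  by rewrite -(ler_pM2r e0); exact: le_trans (lo _) (hi _).
have gMs : g * (M + s) < 2.
  by rewrite -ltr_pdivlMr //; lra.
pose rho0 := Num.max 0 (Num.max (1 - g * m) (g * M - 1)).
have r0 : 0 <= rho0 by rewrite le_max lexx.
have r1 : 1 - g * m <= rho0 by rewrite !le_max lexx orbT.
have r2 : g * M - 1 <= rho0 by rewrite !le_max lexx !orbT.
have gsm : g * s < g * m by rewrite ltr_pM2l.
have r3 : rho0 < 1 - g * s.
  by rewrite !gt_max; apply/and3P; split; nra.
(* The midpoint is positive, as [norm2_sym_mulmx] demands, even when [rho0] is 0, and still below
   [1 - g * s]. *)
pose rho := (rho0 + (1 - g * s)) / 2.
exists rho; first by rewrite /rho; lra.
split=> [|v]; first by rewrite /rho; lra.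
have -> : v - g *: (A *m v) = (1%:M - g *: A) *m v.
  by rewrite mulmxBl mul1mx -scalemxAl.
apply: norm2_sym_mulmx => [||u].
- by rewrite linearB /= linearZ /= trmx1 Asym.
- by rewrite /rho; lra.
rewrite mulmxBl mul1mx -scalemxAl !dot_lin.
have := lo u; have := hi u; have := dot_ge0 u.
set a := dot u u; set b := dot u _ => a0 hb lb.
have rr : rho0 <= rho by rewrite /rho; lra.
rewrite ler_norml; apply/andP; split; nra.
Qed.

End Euclidean.

(** * Projections and first-order optimality conditions *)

Section Projection.
Local Set Implicit Arguments.
Local Unset Strict Implicit.
Context {R : realType}.

Lemma convex_segment (V : lmodType R) (A : set V) a b t :
  convex_set A -> A a -> A b -> 0 <= t <= 1 -> A (a + t *: (b - a)).
Proof.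
move=> cA Aa Ab /andP[t0 t1].
have := cA b a (Itv01 t0 t1) (mem_set Ab) (mem_set Aa).
rewrite inE /conv /= /unstable.onem scalerBl scale1r scalerBr.
by rewrite addrCA.
Qed.

(** Replaces dividing by [t] and letting [t] tend to 0 in both variational inequalities below. *)
Lemma ge0_of_small_quadratic (a b : R) :
  (forall t, 0 < t <= 1 -> 0 <= t * a + t ^+ 2 * b) -> 0 <= a.
Proof.
move=> h; rewrite leNgt; apply/negP => a0.
(* Chosen so that [a + t * |b| = t * a], which is negative when [a] is. *)
pose t := - a / (`|b| - a).
have b0 := normr_ge0 b; have bb := ler_norm b.
have d0 : 0 < `|b| - a by lra.
have t0 : 0 < t by rewrite divr_gt0 // oppr_gt0.
have tE : t * (`|b| - a) = - a by rewrite /t mulfVK // gt_eqF.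
have t1 : t <= 1 by rewrite /t ler_pdivrMr // mul1r; lra.
have /h : 0 < t <= 1 by rewrite t0.
rewrite expr2 -mulrA -mulrDr pmulr_rge0 // => h'.
have : t * b <= t * `|b| by rewrite ler_pM2l.
have : t * a < 0 by rewrite nmulr_llt0.
lra.
Qed.

Lemma norm2_continuous n : continuous (@norm2 R n).
Proof.
move=> v; rewrite /norm2.
apply: (@continuous_comp _ _ _ (fun v : 'cV[R]_n => \sum_i v i 0 ^+ 2)).
  apply: continuous_big => [|i _ w]; first exact: add_continuous.
  apply: (@continuous_comp _ _ _ (fun v : 'cV[R]_n => v i 0) (fun x => x ^+ 2)).
    exact: coord_continuous.
  exact: exprn_continuous.
exact: sqrt_continuous.
Qed.

Lemma norm2_dist_continuous n (y : 'cV[R]_n) : 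
  continuous (fun z : 'cV[R]_n => norm2 (z - y)).
Proof.
move=> z; apply: (@continuous_comp _ _ _ (fun z : 'cV[R]_n => z - y)).
  by apply: (@cvgB _ _ _ (nbhs z)); [exact: cvg_id | exact: cvg_cst].
exact: norm2_continuous.
Qed.

(** Compactness provides a minimizer, so [xget] does not fall back on its default. *)
Lemma proj_onto_min n (A : set 'cV[R]_n) y : A !=set0 -> compact A ->
  argmin (fun z => norm2 (z - y)) A (proj_onto A y).
Proof.
move=> A0 Ac; apply: xgetPex.
have [z /set_mem Az hz] := compact_EVT_min A0 Ac
  (continuous_subspaceT (@norm2_dist_continuous n y)).
by exists z; split=> // t At; apply: hz; rewrite inE.
Qed.

Lemma proj_onto_in n (A : set 'cV[R]_n) y : A !=set0 -> compact A ->
  A (proj_onto A y).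
Proof. by move=> A0 Ac; case: (proj_onto_min y A0 Ac). Qed.

(** Minimality is tested along the segment from the projection towards [z]. *)
Lemma proj_onto_vi n (A : set 'cV[R]_n) y : A !=set0 -> compact A ->
  convex_set A -> forall z, A z ->
  dot (y - proj_onto A y) (z - proj_onto A y) <= 0.
Proof.
move=> A0 Ac Aconv z Az; have [Ap pmin] := proj_onto_min y A0 Ac.
set w := proj_onto A y in Ap pmin *.
rewrite -oppr_ge0.
apply: (@ge0_of_small_quadratic _ (2^-1 * dot (z - w) (z - w))).
move=> t /andP[t0 t1].
have /pmin : A (w + t *: (z - w)).
  by apply: convex_segment => //; rewrite ltW.
rewrite norm2_le.
have -> : w + t *: (z - w) - y = t *: (z - w) - (y - w).
  by rewrite opprB [w + _]addrC addrA.
have -> : w - y = - (y - w) by rewrite opprB.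
move: (y - w) (z - w) => u d; rewrite !dot_lin (dotC d u); lra.
Qed.

(* Both points are projections, characterized by their variational
   inequalities, so this is the nonexpansiveness of the projection. *)
Lemma vi_nonexpansive n (y z u w : 'cV[R]_n) :
  dot (y - u) (w - u) <= 0 -> dot (z - w) (u - w) <= 0 ->
  norm2 (u - w) <= norm2 (y - z).
Proof.
move=> yu zw.
have h : dot (u - w) (u - w) <= dot (y - z) (u - w).
  move: yu zw; rewrite !dot_lin (dotC w u); lra.
have := le_trans h (cauchy_schwarz _ _); rewrite -sqr_norm2 expr2.
have [->|n0] := eqVneq (norm2 (u - w)) 0; first by rewrite norm2_ge0.
by rewrite ler_pM2r // lt_def n0 norm2_ge0.
Qed.

(** The increment along [d = y - x] is exactly [t * dot (Q *m x + r) d] plus half of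
    [t ^+ 2 * dot d (Q *m d)]. Only feasibility of the segment is assumed, which is easy to check
    for a move in a single block. *)
Lemma quadratic_argmin_vi n (Q : 'M[R]_n) r (C : set 'cV[R]_n) x y :
  Q^T = Q -> argmin (quadratic Q r) C x ->
  (forall t, 0 < t <= 1 -> C (x + t *: (y - x))) ->
  0 <= dot (Q *m x + r) (y - x).
Proof.
move=> Qsym [Cx xmin]; move: (y - x) => d Cy.
apply: (@ge0_of_small_quadratic _ (2^-1 * dot d (Q *m d))) => t t01.
have := xmin _ (Cy t t01).
rewrite /quadratic -!mulmxA -/(dot _ _) -/(dot _ _) -/(dot _ _) -/(dot _ _).
rewrite mulmxDr -scalemxAr !dot_lin (dotC d (Q *m x)) dot_mull Qsym; lra.
Qed.

End Projection.

(** * Consequences of total asynchrony *)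

Section Asynchrony.
Local Set Implicit Arguments.
Local Unset Strict Implicit.

Lemma infinite_set_nat_ge (K : set nat) n : infinite_set K ->
  exists2 k, K k & (n <= k)%N.
Proof.
move=> Kinf; apply: contrapT => h; apply: Kinf.
apply: (sub_finite_set _ (finite_II n)) => k Kk /=.
by rewrite ltnNge; apply/negP => nk; apply: h; exists k.
Qed.

Lemma fin_uniform_bound (I : finType) (P : I -> nat -> Prop) :
  (forall i, exists n, forall k, (n <= k)%N -> P i k) ->
  exists n, forall i k, (n <= k)%N -> P i k.
Proof.
move=> /choice[n hn]; exists (\max_i n i) => i k nk.
by apply: hn; apply: leq_trans nk; exact: leq_bigmax.
Qed.

(** Otherwise some pair of agents has stamps below [M] at arbitrarily late update times; these times
    form a sequence in [K i] that contradicts total asynchrony. *)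
Lemma stamps_eventually_ge N (K : 'I_N -> set nat)
    (tau : 'I_N -> 'I_N -> nat -> nat) : totally_asynchronous K tau ->
  forall M, exists n, forall i k, (n <= k)%N ->
    K i k -> forall j, j != i -> (M <= tau i j k)%N.
Proof.
move=> [_ tauoo] M; apply: fin_uniform_bound => i.
suff [n hn] : exists n, forall j k, (n <= k)%N ->
    K i k -> j != i -> (M <= tau i j k)%N.
  by exists n => k nk Kk j; exact: hn.
apply: fin_uniform_bound => j.
have [ji|ji] := boolP (j != i); last by exists 0%N.
apply: contrapT => /forallNP h.
have /choice[kd hkd] n : exists k, [/\ (n <= k)%N, K i k & (tau i j k < M)%N].
  have := h n; apply: contra_notP => /forallNP h' k nk Kk _.
  by rewrite leqNgt; apply/negP => kM; apply: (h' k).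
have kdoo : kd @ \oo --> \oo.
  apply/cvgnyPge => A; near=> d; apply: leq_trans (_ : (d <= _)%N).
    by near: d; exact: nbhs_infty_ge.
  by have [] := hkd d.
have Kkd d : K i (kd d) by have [] := hkd d.
have /cvgnyPge/(_ M)[n _ /(_ n (leqnn n))] := tauoo i j ji kd Kkd kdoo.
by have [_ _] := hkd n; rewrite /= ltnNge => /negP.
Unshelve. all: by end_near. Qed.

(* [e i j k] stands for the distance of agent i's copy of block j to its target.
   The sets of states with all errors at most [q ^+ s * D] are the nested boxes
   of Bertsekas and Tsitsiklis' asynchronous convergence theorem. *)
Lemma async_geometric_decay (R : realType) N (K : 'I_N -> set nat)
    (tau : 'I_N -> 'I_N -> nat -> nat) (e : 'I_N -> 'I_N -> nat -> R)
    (q D : R) :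
  totally_asynchronous K tau ->
  0 <= q -> 0 <= D ->
  (forall i j k, e i j k <= D) ->
  (forall i k c, 0 <= c -> K i k -> (forall j, e i j k <= c) ->
     e i i k.+1 <= q * c) ->
  (forall i k, ~ K i k -> e i i k.+1 = e i i k) ->
  (forall i j k, j != i -> (0 < tau i j k)%N -> e i j k = e j j (tau i j k)) ->
  forall s, exists n, forall i k, (n <= k)%N ->
    e i i k <= q ^+ s * D /\ (K i k -> forall j, e i j k <= q ^+ s * D).
Proof.
move=> async q0 D0 eD eK eidle etau; have [Kinf _] := async.
(* Foreign blocks are controlled at update times only: there the stamps are constrained, and there
   the values are used. *)
elim=> [|s [n IHn]].
  by exists 0%N => i k _; rewrite expr0 mul1r; split.
have c0 : 0 <= q ^+ s * D by rewrite mulr_ge0 ?exprn_ge0.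
have eS i k : (n <= k)%N -> K i k -> e i i k.+1 <= q ^+ s.+1 * D.
  move=> nk Kk; rewrite exprS -mulrA; apply: eK => //.
  by have [_] := IHn i k nk; exact.
have [T hT] : exists T, forall i k, (T <= k)%N -> e i i k <= q ^+ s.+1 * D.
  apply: fin_uniform_bound => i.
  (* One update past [n] brings the own block into the smaller box; later updates and idle steps
     keep it there. *)
  have [m Km nm] := infinite_set_nat_ge n (Kinf i).
  exists m.+1; elim=> // k IHk mk; have [Kk|nKk] := pselect (K i k).
    by apply: eS => //; exact: leq_trans nm _.
  move: mk; rewrite ltnS leq_eqVlt => /predU1P[mk|mk].
    by rewrite -mk in nKk.
  by rewrite eidle //; exact: IHk.
(* Stamps at least 1 allow the use of [etau]; stamps at least [T] refer to values already in the
   smaller box. *)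
have [m hm] := stamps_eventually_ge async (maxn 1 T).
exists (maxn T m) => i k; rewrite geq_max => /andP[Tk mk].
split; first exact: hT.
move=> Kk j; have [->|ji] := eqVneq j i; first exact: hT.
have := hm i k mk Kk j ji; rewrite geq_max => /andP[t0 tT].
by rewrite etau //; exact: hT.
Qed.

End Asynchrony.

(** * Block decomposition and the contraction for one agent *)

Section Blocks.
Local Set Implicit Arguments.
Local Unset Strict Implicit.
Context {R : realType} {N : nat} {p : 'I_N -> nat}.
Notation n := (\sum_i p i)%N.

(** Perturbing along such vectors turns facts about [Q] and the minimizer into facts about a single
    agent. *)
Definition block_vec (i : 'I_N) (w : 'cV[R]_(p i)) : 'cV[R]_n :=
  \mxcol_j eqtype.dfwith (fun j => 0 : 'cV[R]_(p j)) w j.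

Arguments block_vec : clear implicits.

Lemma block_vec_in i w : submxcol (block_vec i w) i = w.
Proof. by rewrite mxcolK dfwith_in. Qed.

Lemma block_vec_out i w j : i != j -> submxcol (block_vec i w) j = 0.
Proof. by move=> ij; rewrite mxcolK dfwith_out. Qed.

Lemma dot_blocks (u v : 'cV[R]_n) :
  dot u v = \sum_i dot (submxcol u i) (submxcol v i).
Proof.
rewrite /dot -[in LHS](submxcolK u) -[in LHS](submxcolK v) tr_mxcol.
by rewrite mul_mxrow_mxcol summxE.
Qed.

Lemma dot_block_vec (u : 'cV[R]_n) i w :
  dot u (block_vec i w) = dot (submxcol u i) w.
Proof.
rewrite dot_blocks (bigD1 i) //= block_vec_in big1 ?addr0 // => j ji.
by rewrite block_vec_out 1?eq_sym // -(scale0r 0) dotZr mul0r.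
Qed.

Lemma submxcol_mulmx (Q : 'M[R]_n) (v : 'cV[R]_n) i :
  submxcol (Q *m v) i = \sum_j submxblock Q i j *m submxcol v j.
Proof.
rewrite -submxcol_mul -[in LHS](submxrowK (submxcol Q i)).
rewrite -[in LHS](submxcolK v) mul_mxrow_mxcol.
by apply: eq_bigr => j _; rewrite submxblockEv.
Qed.

(** Transfers positive semidefiniteness from [Q] to its diagonal blocks. *)
Lemma dot_diag_block (Q : 'M[R]_n) i (w : 'cV[R]_(p i)) :
  dot w (submxblock Q i i *m w) = dot (block_vec i w) (Q *m block_vec i w).
Proof.
rewrite (dotC (block_vec i w)) dot_block_vec dotC submxcol_mulmx.
rewrite (bigD1 i) //= block_vec_in big1 ?addr0 // => j ji.
by rewrite block_vec_out 1?eq_sym // mulmx0.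
Qed.

Lemma submxcolZ a (v : 'cV[R]_n) i : submxcol (a *: v) i = a *: submxcol v i.
Proof. by apply/colP => k; rewrite !mxE. Qed.

(** Replacing block [i] of [xhat] by a point between it and [z] stays in the product, so optimality
    splits by blocks. *)
Lemma quadratic_argmin_block_vi (X : forall i : 'I_N, set 'cV[R]_(p i))
    (Q : 'M[R]_n) (r xhat : 'cV[R]_n) :
  (forall i, convex_set (X i)) -> Q^T = Q ->
  argmin (quadratic Q r) (block_prod X) xhat ->
  forall i z, X i z ->
    0 <= dot (submxcol (Q *m xhat + r) i) (z - submxcol xhat i).
Proof.
move=> Xconv Qsym xmin i z Xz; have [Xhat _] := xmin.
have := @quadratic_argmin_vi _ _ _ _ _ _
  (xhat + block_vec i (z - submxcol xhat i)) Qsym xmin.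
rewrite addrC addKr dot_block_vec; apply => t /andP[t0 t1] j.
rewrite submxcolD submxcolZ; have [<-|ij] := eqVneq i j.
  by rewrite block_vec_in; apply: convex_segment => //; rewrite ltW.
by rewrite block_vec_out // scaler0 addr0; exact: Xhat.
Qed.

Lemma block_gradient_contraction (X : forall i : 'I_N, set 'cV[R]_(p i))
    (Q : 'M[R]_n) (r xhat : 'cV[R]_n) (gamma : 'I_N -> R) (i : 'I_N) :
  (0 < p i)%N -> X i !=set0 -> compact (X i) ->
  (forall i, convex_set (X i)) ->
  Q^T = Q -> (forall v : 'cV[R]_n, 0 <= (v^T *m Q *m v) 0 0) ->
  strict_block_diag_dominant Q ->
  argmin (quadratic Q r) (block_prod X) xhat ->
  0 < gamma i < 2 / \sum_j opnorm2 (submxblock Q i j) ->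
  exists q, 0 <= q < 1 /\ forall (x : 'cV[R]_n) c,
    (forall j, norm2 (submxcol x j - submxcol xhat j) <= c) ->
    norm2 (proj_onto (X i) (submxcol x i
      - gamma i *: (submxcol Q i *m x + submxcol r i)) - submxcol xhat i)
      <= q * c.
Proof.
move=> p0 X0 Xc Xconv Qsym Qpsd Qdd xmin.
have [Qu Qs] := Qdd i; rewrite (bigD1 i) //=.
set s := \sum_(_ | _) _ in Qs * => /andP[g0 gM].
have s0 : 0 <= s by apply: sumr_ge0 => j _; exact: opnorm2_ge0.
have [|v|||rho rho0 [rho1 hrho]] :=
  @gradient_step_contraction _ _ (submxblock Q i i) s (gamma i) p0 _ _ Qu.
- by rewrite tr_submxblock Qsym.
- by rewrite dot_diag_block /dot mulmxA.
- by rewrite s0.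
- by rewrite g0.
exists (rho + gamma i * s); split.
  by rewrite rho1 addr_ge0 // mulr_ge0 // ltW.
move=> x c xc; set g := gamma i in g0 gM rho1 hrho *.
set y := submxcol x i - _.
have [Xhat _] := xmin.
(* The unprojected step at [xhat]. By blockwise optimality, block [i] of [xhat] satisfies the
   variational inequality of its projection. *)
pose yhat := submxcol xhat i - g *: submxcol (Q *m xhat + r) i.
apply: le_trans (@vi_nonexpansive _ _ y yhat _ _ _ _) _.
- exact: proj_onto_vi.
- rewrite /yhat addrAC subrr add0r dotNl dotZl oppr_le0 mulr_ge0 ?(ltW g0) //.
  by apply: (quadratic_argmin_block_vi Xconv Qsym xmin); exact: proj_onto_in.
set u := x - xhat.
have uE j : submxcol u j = submxcol x j - submxcol xhat j by rewrite submxcolB.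
(* The diagonal part contributes [rho * c], the coupling with other blocks at most [g * s * c]. *)
have -> : y - yhat = (submxcol u i - g *: (submxblock Q i i *m submxcol u i))
    - g *: \sum_(j | j != i) submxblock Q i j *m submxcol u j.
  rewrite -[RHS]addrA -[in RHS]opprD -[in RHS]scalerDr.
  rewrite -(bigD1 i (P := predT)
    (F := fun j => submxblock Q i j *m submxcol u j)) //=.
  rewrite -submxcol_mulmx /y /yhat submxcol_mul -submxcolD mulmxBr.
  by apply/colP => k; rewrite !mxE; ring.
apply: le_trans (ler_norm2D _ _) _.
rewrite mulrDl lerD //.
  by apply: le_trans (hrho _) _; rewrite ler_wpM2l // uE.
rewrite norm2N norm2Z gtr0_norm // -mulrA ler_pM2l // mulr_suml.
apply: le_trans (ler_norm2_sum _ _ _) _; apply: ler_sum => j ji.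
apply: le_trans (norm2_mulmx _ _) _.
by rewrite ler_wpM2l ?opnorm2_ge0 // uE.
Qed.

Lemma norm2_coord_block (v : 'cV[R]_n) s :
  `|v s 0| <= norm2 (submxcol v (tagnat.sig1 s)).
Proof.
apply: le_trans (norm2_coord _ (tagnat.sig2 s)).
by rewrite mxE tagnat.sig2K.
Qed.

End Blocks.

(** * From norm estimates to convergence in the canonical topology *)

Section Convergence.
Local Set Implicit Arguments.
Local Unset Strict Implicit.
Context {R : realType} {T : Type} {F : set_system T} {FF : Filter F}.

(** The filter is arbitrary so as to cover both [\oo] and [within (K i) \oo]. *)
Lemma cvg_coord n (f : T -> 'cV[R]_n) l :
  (forall e, 0 < e -> \forall k \near F, forall s, `|(f k - l) s 0| <= e) ->
  f @ F --> l.
Proof.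
move=> h; apply/cvgrPdist_le => e e0; near=> k.
rewrite -normrN opprB [leLHS]/Num.norm /= mx_normrE.
apply/bigmax_leP; split=> [|[s t] _ /=]; first exact: ltW.
by rewrite (ord1 t); move: s; near: k; exact: h.
Unshelve. all: by end_near. Qed.

Lemma cvg_norm2 n (f : T -> 'cV[R]_n) l :
  (forall e, 0 < e -> \forall k \near F, norm2 (f k - l) <= e) -> f @ F --> l.
Proof.
move=> h; apply: cvg_coord => e e0; near=> k => s.
by apply: le_trans (norm2_coord _ _) _; near: k; exact: h.
Unshelve. all: by end_near. Qed.

Lemma cvg_norm2_blocks N (p : 'I_N -> nat) (f : T -> 'cV[R]_(\sum_i p i)) l :
  (forall e, 0 < e -> \forall k \near F, forall j,
     norm2 (submxcol (f k) j - submxcol l j) <= e) ->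
  f @ F --> l.
Proof.
move=> h; apply: cvg_coord => e e0; near=> k => s.
apply: le_trans (norm2_coord_block _ _) _; rewrite submxcolB.
by move: (tagnat.sig1 s); near: k; exact: h.
Unshelve. all: by end_near. Qed.

End Convergence.

(** Merges the contraction factors of the agents into one. Seeding the maximum with 0 makes it
    non-negative, and [0 < b] keeps the bound strict. *)
Lemma max_lt_bound {R : realType} N (q : 'I_N -> R) (b : R) : 0 < b ->
  (forall i, q i < b) -> exists2 m, 0 <= m < b & forall i, q i <= m.
Proof.
move=> b0 qb; exists (\big[Num.max/0]_i q i); last first.
  by move=> i; exact: le_bigmax.
by rewrite bigmax_ge_id; apply/bigmax_ltP; split.
Qed.

(** * Invariants of a run *)

Section Run.
Context {R : realType} {N : nat} {p : 'I_N -> nat}.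
Context (X : forall i : 'I_N, set 'cV[R]_(p i)).
Context (Q : 'M[R]_(\sum_i p i)) (r : 'cV[R]_(\sum_i p i)) (gamma : 'I_N -> R).
Context (K : 'I_N -> set nat) (rcv : 'I_N -> 'I_N -> set nat).
Context (tau : 'I_N -> 'I_N -> nat -> nat).
Context (x : 'I_N -> nat -> 'cV[R]_(\sum_i p i)).
Context (run : async_run X Q r gamma K rcv tau x).

Local Set Implicit Arguments.
Local Unset Strict Implicit.

Lemma run_own_in i k : (forall i, X i !=set0) -> (forall i, compact (X i)) ->
  X i (submxcol (x i k) i).
Proof.
move=> X0 Xc; elim: k => [|k IHk]; first exact: (run_init run i i).
have [Kk|Kk] := pselect (K i k); last by rewrite (run_idle run).
by rewrite (run_update run) //; exact: proj_onto_in.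
Qed.

(** Yields the uniform error bound that starts the decay. Own blocks are treated first because a
    message may carry the owner's value from any admissible time. *)
Lemma run_in i k : (forall i, X i !=set0) -> (forall i, compact (X i)) ->
  block_prod X (x i k).
Proof.
move=> X0 Xc; elim: k => [|k IHk] j; first exact: (run_init run i j).
have [->|ji] := eqVneq j i; first exact: run_own_in.
have [rk|rk] := pselect (rcv i j k.+1); last by rewrite (run_keep run).
by rewrite (run_receive run) //; exact: run_own_in.
Qed.

(* Initial copies need not agree, so this fails for stamp 0. *)
Lemma run_stamp i j k : j != i -> (0 < tau i j k)%N ->
  submxcol (x i k) j = submxcol (x j (tau i j k)) j.
Proof.
move=> ji; elim: k => [|k IHk].
  by have := run_stamp_causal run 0 ji; rewrite leqn0 => /eqP ->.
have [rk|rk] := pselect (rcv i j k.+1); first by rewrite (run_receive run).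
by rewrite (run_stamp_keep run) // (run_keep run).
Qed.

End Run.

(** Dominance keeps the eigenvalues of the diagonal blocks away from 0; positive semidefiniteness
    fixes their sign. Total asynchrony constrains stamps along update times only, and between
    updates a stale message may arrive. Hence the full copy converges along [K i], and along all
    times once its stamps tend to infinity. *)
Theorem theorem2 (R : realType) (N : nat) (p : 'I_N -> nat)
    (p_gt0 : forall i, (0 < p i)%N)
    (X : forall i : 'I_N, set 'cV[R]_(p i))
    (X_nonempty : forall i, X i !=set0)
    (X_compact : forall i, compact (X i))
    (X_convex : forall i, convex_set (X i))
    (Q : 'M[R]_(\sum_i p i)) (r : 'cV[R]_(\sum_i p i))
    (Q_sym : Q^T = Q)
    (Q_psd : forall v : 'cV[R]_(\sum_i p i), 0 <= (v^T *m Q *m v) 0 0)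
    (Q_sbdd : strict_block_diag_dominant Q)
    (xhat : 'cV[R]_(\sum_i p i))
    (xhat_min : argmin (quadratic Q r) (block_prod X) xhat)
    (K : 'I_N -> set nat) (rcv : 'I_N -> 'I_N -> set nat)
    (tau : 'I_N -> 'I_N -> nat -> nat)
    (async : totally_asynchronous K tau)
    (gamma : 'I_N -> R)
    (gamma_bound : forall i,
       0 < gamma i < 2 / \sum_j opnorm2 (submxblock Q i j))
    (x : 'I_N -> nat -> 'cV[R]_(\sum_i p i))
    (run : async_run X Q r gamma K rcv tau x) :
  forall i : 'I_N,
    [/\ submxcol (x i k) i @[k --> \oo] --> submxcol xhat i,
        x i k @[k --> within (K i) \oo] --> xhat
      & (forall j, j != i -> tau i j k @[k --> \oo] --> \oo) ->
        x i k @[k --> \oo] --> xhat].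
Proof.
pose e i j k := norm2 (submxcol (x i k) j - submxcol xhat j).
have [q hq] := choice (fun i => block_gradient_contraction (p_gt0 i)
  (X_nonempty i) (X_compact i) X_convex Q_sym Q_psd Q_sbdd xhat_min
  (gamma_bound i)).
have [||Q0 /andP[Q00 Q01] qQ] := @max_lt_bound _ _ q 1 => //.
  by move=> i; have [/andP[]] := hq i.
have /choice[D hD] : forall j, exists D, forall z, X j z ->
    norm2 (z - submxcol xhat j) <= D.
  move=> j; have [z _ hz] := compact_EVT_max (X_nonempty j) (X_compact j)
    (continuous_subspaceT (@norm2_dist_continuous _ _ (submxcol xhat j))).
  by exists (norm2 (z - submxcol xhat j)) => t Xt; apply: hz; rewrite inE.
pose D0 := \big[Num.max/0]_j D j.
have D00 : 0 <= D0 by exact: bigmax_ge_id.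
have eD i j k : e i j k <= D0.
  apply: le_trans (le_bigmax 0 D j); apply: hD.
  exact: (run_in run i k X_nonempty X_compact j).
have decay := @async_geometric_decay R N K tau e Q0 D0 async.
have {}decay : forall eps, 0 < eps -> exists n, forall i k, (n <= k)%N ->
    e i i k <= eps /\ (K i k -> forall j, e i j k <= eps).
  move=> eps eps0.
  have [s hs] : exists s, Q0 ^+ s * D0 <= eps.
    have /cvgrPdist_le/(_ eps eps0)[s _ /(_ s (leqnn s))] :=
      @cvg_geometric R D0 Q0 (ltac:(by rewrite ger0_norm)).
    rewrite /= /geometric /= sub0r normrN ger0_norm ?mulr_ge0 ?exprn_ge0 //.
    by rewrite mulrC; exists s.
  have [|||n hn] := decay Q00 D00 eD _ _ _ s.
  - move=> i k c c0 Kk ec; rewrite /e (run_update run) //.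
    have [_ hqi] := hq i; apply: le_trans (hqi (x i k) c ec) _.
    by rewrite ler_wpM2r.
  - by move=> i k nKk; rewrite /e (run_idle run).
  - by move=> i j k ji t0; rewrite /e (run_stamp run).
  exists n => i k nk; have [h1 h2] := hn i k nk.
  by split=> [|Kk j]; apply: le_trans hs; [exact: h1|exact: h2].
move=> i; split=> [||tauoo].
- apply: cvg_norm2 => eps /decay[n hn]; exists n => // k /= nk.
  by have [] := hn i k nk.
- apply: cvg_norm2_blocks => eps /decay[n hn].
  rewrite near_withinE; exists n => // k /= nk Kk.
  by have [_] := hn i k nk; exact.
apply: cvg_norm2_blocks => eps /decay[n hn].
apply: filter_forall => j; have [->|ji] := eqVneq j i.
  (* For [j = i] the own-block bound applies directly. *)
  by exists n => // k /= nk; have [] := hn i k nk.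
have /cvgnyPge/(_ (maxn 1 n)) := tauoo j ji; apply: filterS => k.
rewrite geq_max => /andP[t0 nt]; rewrite (run_stamp run) //.
by have [] := hn j _ nt.
Qed.
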